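(* Let $n=3$. The field $\mathcal{I}_{3,0}$ of absolute first-order joint projective differential invariants of three points is the rational function field $$\mathcal{I}_{3,0}=\mathbb{R}\bigl(\zeta_{12},\zeta_{23},\zeta_{13},\tau\bigr),$$ where $$\zeta_{12}=\Phi^{(1)}_{12}\Phi^{(2)}_{12},\quad \zeta_{23}=\Phi^{(2)}_{23}\Phi^{(3)}_{23},\quad \zeta_{13}=\Phi^{(1)}_{13}\Phi^{(3)}_{13},\quad \tau=\Phi^{(1)}_{13}\Phi^{(3)}_{23}\Phi^{(2)}_{12}$$ are algebraically independent (over $\mathbb{R}$) absolute first-order joint projective invariants.
   Context: Let $\mathcal{M}=(\mathbb{R}^2\times\mathbb{R}^2)^n$ be the $n$-fold first-order jet space of point configurations, with coordinates $\boldsymbol{x}=(x_i,y_i,p_i,q_i)_{i=1}^n$, where $(p_i,q_i)$ represents the gradient $(\partial_x u,\partial_y u)$ of a function $u$ at $(x_i,y_i)$. The group $G=PGL(3,\mathbb{R})$ acts (rationally, i.e. where denominators do not vanish) on $\mathcal{M}$: for $g=[T]$ with $T=\begin{pmatrix} a_1&a_2&a_3\\ b_1&b_2&b_3\\ c_1&c_2&c_3\end{pmatrix}\in GL(3,\mathbb{R})$, $$\widetilde x_i=\frac{a_1x_i+a_2y_i+a_3}{c_1x_i+c_2y_i+c_3},\qquad \widetilde y_i=\frac{b_1x_i+b_2y_i+b_3}{c_1x_i+c_2y_i+c_3},$$ and $(\widetilde p_i,\widetilde q_i)$ is given by the standard first prolongation (chain rule for $u(x,y)=\widetilde u(\widetilde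 x,\widetilde y)$): $p_i=\widetilde p_i\,\partial_x\widetilde x+\widetilde q_i\,\partial_x\widetilde y$ and $q_i=\widetilde p_i\,\partial_y\widetilde x+\widetilde q_i\,\partial_y\widetilde y$, where the partial derivatives of the projective map are evaluated at $(x_i,y_i)$. The same $g$ acts on all $n$ blocks. $\mathcal{I}_{n,0}$ denotes the field of absolute invariants: all $F\in\mathbb{R}(x_i,y_i,p_i,q_i\mid i=1,\dots,n)$ with $F(g\cdot\boldsymbol{x})=F(\boldsymbol{x})$ for all $g\in G$ (as rational functions of $\boldsymbol{x}$). Notation: for $i\neq j$, $\Phi^{(k)}_{ij}=(x_i-x_j)p_k+(y_i-y_j)q_k$. *)

(* Defs.v *)
From mathcomp Require Import all_boot all_order all_algebra.
From mathcomp Require Import fraction generic_quotient reals mpoly ring.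

Set Implicit Arguments.
Unset Strict Implicit.
Unset Printing Implicit Defensive.

Import GRing.Theory.
Local Open Scope ring_scope.

(* R(X_0, ..., X_(m-1)) *)
Notation ratfun R m := {fraction {mpoly R[m]}}.

Definition ratC (R : realType) (m : nat) (c : R) : ratfun R m :=
  tofrac c%:MP_[m].

Definition ratX (R : realType) (m : nat) (k : 'I_m) : ratfun R m :=
  tofrac ('X_k : {mpoly R[m]}).

(* P(v_0, ..., v_(k-1)), for a polynomial P and rational functions v_j *)
Definition poly_subst (R : realType) (k m : nat) (v : 'I_k -> ratfun R m)
    (P : {mpoly R[k]}) : ratfun R m :=
  mmap (@ratC R m) v P.

(* F(v_0, ..., v_(k-1)) is defined and equal to G: some fraction representing
   F has a denominator that does not vanish at v, and its value is G. The value
   does not depend on the fraction chosen. *)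
Definition rat_subst (R : realType) (k m : nat) (v : 'I_k -> ratfun R m)
    (F : ratfun R k) (G : ratfun R m) : Prop :=
  exists N D : {mpoly R[k]},
    [/\ F = tofrac N / tofrac D,
        poly_subst v D != 0
      & G = poly_subst v N / poly_subst v D].

(* The partial derivative of F with respect to the k-th variable, by the
   quotient rule on a representative; see pderiv_frac for independence. *)
Definition pderiv (R : realType) (m : nat) (k : 'I_m) (F : ratfun R m) :
    ratfun R m :=
  let N := \n_(repr F) in let D := \d_(repr F) in
  tofrac (mderiv k N * D - N * mderiv k D) / tofrac (D ^+ 2).

Lemma pderiv_frac (R : realType) (m : nat) (k : 'I_m) (N D : {mpoly R[m]}) :
  D != 0 ->
  pderiv k (tofrac N / tofrac D) =
    tofrac (mderiv k N * D - N * mderiv k D) / tofrac (D ^+ 2).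
Proof.
have pi_numden (x : {ratio {mpoly R[m]}}) :
    tofrac \n_x = \pi_(ratfun R m)%qT x * tofrac \d_x.
  unlock tofrac; rewrite -[RHS]FracField.pi_mul; apply/eqmodP => /=.
  rewrite FracField.equivfE /FracField.mulf.
  by rewrite !numden_Ratio ?mulf_neq0 ?oner_neq0 ?denom_ratioP // mulr1 mul1r.
have numden (F : ratfun R m) : tofrac \n_(repr F) = F * tofrac \d_(repr F).
  by rewrite pi_numden reprK.
move=> D0; set F := _ / _; rewrite /pderiv.
move: (numden F) (denom_ratioP (repr F)).
move: \n_(repr F) \d_(repr F) => N' D' E D'0.
have {}E : N' * D = N * D'.
  apply/eqP; rewrite -tofrac_eq !tofracM E /F mulrAC divfK ?tofrac_eq0 //.
have dE : mderiv k N' * D + N' * mderiv k D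
          - (mderiv k N * D' + N * mderiv k D') = 0.
  by rewrite -!mderivM E subrr.
apply/eqP; rewrite eqr_div ?tofrac_eq0 ?expf_neq0 // -!tofracM tofrac_eq.
rewrite -subr_eq0; apply/eqP.
transitivity (D * D' * (mderiv k N' * D + N' * mderiv k D
          - (mderiv k N * D' + N * mderiv k D'))
   + (N * D' - N' * D) * (D' * mderiv k D + D * mderiv k D')); first by ring.
by rewrite dE E subrr mulr0 mul0r addr0.
Qed.

(* R(s_j | j < k): the smallest subfield of R(X) that contains the constants
   and all the s_j *)
Definition in_adjoin (R : realType) (k m : nat) (s : 'I_k -> ratfun R m)
    (F : ratfun R m) : Prop :=
  forall S : {pred ratfun R m},
    GRing.divring_closed S ->
    (forall c : R, ratC m c \in S) ->
    (forall j, s j \in S) ->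
    F \in S.

Definition alg_independent (R : realType) (k m : nat)
    (s : 'I_k -> ratfun R m) : Prop :=
  forall P : {mpoly R[k]}, poly_subst s P = 0 -> P = 0.

Definition cx : 'I_4 := @Ordinal 4 0 isT.
Definition cy : 'I_4 := @Ordinal 4 1 isT.
Definition cp : 'I_4 := @Ordinal 4 2 isT.
Definition cq : 'I_4 := @Ordinal 4 3 isT.

(* The field R(x_i, y_i, p_i, q_i | i < n); coordinate c of the point i is the
   variable number [mxvec_index i c]. *)
Notation jetfun R n := (ratfun R (n * 4)).

Definition jvar (R : realType) (n : nat) (i : 'I_n) (c : 'I_4) : jetfun R n :=
  ratX R (mxvec_index i c).

Section Action.
Variables (R : realType) (n : nat) (T : 'M[R]_3) (i : 'I_n).

(* The r-th entry of T (x_i, y_i, 1)^t *)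
Definition hom_image (r : 'I_3) : jetfun R n :=
  ratC _ (T r (@Ordinal 3 0 isT)) * jvar R i cx
  + ratC _ (T r (@Ordinal 3 1 isT)) * jvar R i cy
  + ratC _ (T r (@Ordinal 3 2 isT)).

Definition xt : jetfun R n :=
  hom_image (@Ordinal 3 0 isT) / hom_image (@Ordinal 3 2 isT).
Definition yt : jetfun R n :=
  hom_image (@Ordinal 3 1 isT) / hom_image (@Ordinal 3 2 isT).

Definition jacobian : 'M[jetfun R n]_2 :=
  \matrix_(a < 2, b < 2)
    pderiv (mxvec_index i (if b == 0 then cx else cy))
           (if a == 0 then xt else yt).

Definition grad : 'rV[jetfun R n]_2 :=
  \row_(b < 2) jvar R i (if b == 0 then cp else cq).

(* The chain rule reads [grad = gradt *m jacobian]; for invertible T it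
   determines gradt, see chain_rule. *)
Definition gradt : 'rV[jetfun R n]_2 := grad *m invmx jacobian.

Definition act_point : 'rV[jetfun R n]_4 :=
  \row_(c < 4)
    if c == cx then xt else if c == cy then yt
    else if c == cp then gradt 0 0 else gradt 0 1.

Lemma chain_rule : T \in unitmx -> grad = gradt *m jacobian.
Proof.
move=> uT; rewrite /gradt mulmxKV //.
pose kx := mxvec_index i cx; pose ky := mxvec_index i cy.
have neq_xy : (kx == ky) = false.
  by apply/negP => /eqP /cast_ord_inj /enum_rank_inj [].
pose o0 := @Ordinal 3 0 isT; pose o1 := @Ordinal 3 1 isT.
pose o2 := @Ordinal 3 2 isT.
pose H r : {mpoly R[n * 4]} :=
  (T r o0)%:MP * 'X_kx + (T r o1)%:MP * 'X_ky + (T r o2)%:MP.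
have HE r : hom_image r = tofrac (H r) by rewrite /H !tofracD !tofracM.
have dX k l : mderiv k ('X_l : {mpoly R[n * 4]}) = (l == k)%:R.
  rewrite mderivX mnm1E; case: eqP => [->|_]; last by rewrite scale0r.
  suff -> : (U_(k) - U_(k))%MM = 0%MM by rewrite mpolyX0 scale1r.
  by apply/mnmP => j; rewrite mnmBE mnm0E subnn.
have dHx r : mderiv kx (H r) = (T r o0)%:MP.
  rewrite /H !mderivD !mderivM !mderivC !dX eqxx (eq_sym ky) neq_xy.
  by rewrite !mul0r !mulr0 mulr1 !add0r !addr0.
have dHy r : mderiv ky (H r) = (T r o1)%:MP.
  rewrite /H !mderivD !mderivM !mderivC !dX eqxx neq_xy.
  by rewrite !mul0r !mulr0 mulr1 !add0r !addr0.
pose t (a b : nat) := T (inord a) (inord b).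
have tE a b : T a b = t a b by rewrite /t !inord_val.
have detT : \det T = t 0%N 0%N * (t 1 1 * t 2 2 - t 1 2 * t 2 1)
   - t 0%N 1 * (t 1 0%N * t 2 2 - t 1 2 * t 2 0%N)
   + t 0%N 2 * (t 1 0%N * t 2 1 - t 1 1 * t 2 0%N).
  rewrite (expand_det_row _ o0) !big_ord_recl big_ord0 /cofactor.
  rewrite !(expand_det_row _ 0) !big_ord_recl !big_ord0 /cofactor !det_mx11 !mxE.
  by rewrite !tE /= /bump /=; ring.
have W0 : H o2 != 0.
  move: uT; rewrite unitmxE unitfE; apply: contraNneq => H0.
  have T0 : T o2 o0 = 0.
    by apply: (can_inj (@mpolyCK (n * 4) R)); rewrite -dHx H0 mderiv0.
  have T1 : T o2 o1 = 0.
    by apply: (can_inj (@mpolyCK (n * 4) R)); rewrite -dHy H0 mderiv0.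
  have T2 : T o2 o2 = 0.
    apply: (can_inj (@mpolyCK (n * 4) R)).
    by rewrite -[RHS]H0 /H T0 T1 mpolyC0 !mul0r !add0r.
  by move: T0 T1 T2; rewrite detT !tE /= => -> -> ->; rewrite !mulr0 !subr0 !mulr0 addr0 subr0.
rewrite unitmxE unitfE.
have -> : \det jacobian = tofrac (\det T)%:MP / tofrac (H o2 ^+ 3).
  rewrite (expand_det_row _ 0) !big_ord_recl big_ord0 /cofactor !det_mx11 !mxE.
  rewrite /= /xt /yt !HE -/kx -/ky !pderiv_frac // !dHx !dHy.
  pose M (r s : 'I_3) := (T r s)%:MP_[n * 4] * H o2 - H r * (T o2 s)%:MP.
  rewrite -/(M o0 o0) -/(M o0 o1) -/(M o1 o0) -/(M o1 o1).
  have key : M o0 o0 * M o1 o1 - M o0 o1 * M o1 o0 = (\det T)%:MP * H o2.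
    by rewrite /M /H detT !tE /= !(mpolyCB, mpolyCD, mpolyCM); ring.
  have w0 : tofrac (H o2) != 0 by rewrite tofrac_eq0.
  have aux (K : fieldType) (a b c d e w : K) : w != 0 ->
      a * b - c * d = e * w ->
      a / w ^+ 2 * ((-1) ^+ (0 + 0) * (b / w ^+ 2))
      + (c / w ^+ 2 * ((-1) ^+ (0 + bump 0 0) * (d / w ^+ 2)) + 0) = e / w ^+ 3.
    move=> {}w0 abcd; rewrite /bump /= expr0 expr1.
    transitivity ((a * b - c * d) / w ^+ 4); first by field.
    by rewrite abcd; field.
  have wX k : tofrac (H o2 ^+ k) = tofrac (H o2) ^+ k by exact: tofracXn.
  rewrite 2!wX; apply: aux => //.
  by rewrite -!tofracM -tofracB key.
rewrite mulf_neq0 ?invr_eq0 ?tofrac_eq0 ?expf_neq0 //.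
by rewrite mpolyC_eq0 -unitfE -unitmxE.
Qed.

End Action.

(* The coordinates of g . x for g = [T], in the order of the variables *)
Definition act (R : realType) (n : nat) (T : 'M[R]_3) (k : 'I_(n * 4)) :
    jetfun R n :=
  mxvec (\matrix_(i < n) act_point T i) 0 k.

(* F belongs to I_(n,0): F(g . x) = F(x) for all g in PGL(3, R) *)
Definition abs_invariant (R : realType) (n : nat) (F : jetfun R n) : Prop :=
  forall T : 'M[R]_3, T \in unitmx -> rat_subst (@act R n T) F F.

(* Phi^(k)_(i j) *)
Definition Phi (R : realType) (n : nat) (k i j : 'I_n) : jetfun R n :=
  (jvar R i cx - jvar R j cx) * jvar R k cp
  + (jvar R i cy - jvar R j cy) * jvar R k cq.

Definition zeta (R : realType) (n : nat) (i j : 'I_n) : jetfun R n :=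
  Phi R i i j * Phi R j i j.

Definition pt1 : 'I_3 := @Ordinal 3 0 isT.
Definition pt2 : 'I_3 := @Ordinal 3 1 isT.
Definition pt3 : 'I_3 := @Ordinal 3 2 isT.

Definition tau (R : realType) : jetfun R 3 :=
  Phi R pt1 pt1 pt3 * Phi R pt3 pt2 pt3 * Phi R pt2 pt1 pt2.

Definition generators (R : realType) (j : 'I_4) : jetfun R 3 :=
  tnth [tuple zeta R pt1 pt2; zeta R pt2 pt3; zeta R pt1 pt3; tau R] j.

(* Main.v *)
Require Import Defs.
From HB Require Import structures.
From mathcomp Require Import all_boot all_order all_algebra.
From mathcomp Require Import fraction generic_quotient reals mpoly ring boolp.

(** Attach to the point i the homogeneous column X_i = (x_i, y_i, 1) and to its
    gradient the homogeneous row P_i = (p_i, q_i, - x_i p_i - y_i q_i), the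
    equation of the line through the point with that gradient as normal, so
    that P_i X_i = 0.  A projective transformation T acts by X_i -> T X_i / w_i
    and P_i -> w_i P_i T^-1, where the weight w_i is the last entry of T X_i
    ([act_proj_act]; the second rule comes from inverting the Jacobian of the
    map, [covector_transport]).  Hence P_k X_i is multiplied by w_k / w_i, and a
    product of such pairings along closed cycles of indices is invariant:
    these are the three zeta and tau ([invariants_moved]).  The invariants form
    a field that contains the constants, so R(zeta, tau) consists of
    invariants.

    Conversely, for three points that are not collinear, any choice of nonzero
    weights comes from a unique T that sends them to three prescribed points
    that are not collinear.  The matrix of the pairings P_k X_i determines the
    gradients, and two generic such matrices with the same zeta and tau differ
    by conjugation by a diagonal matrix.  So generic real configurations with the same zeta and tau lie in
    the same orbit ([same_orbit]).  Fix a generic configuration x0, and let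
    nu(x) be the configuration with the points of x0, the pairings P_1 X_2 and
    P_1 X_3 of x0, and the values zeta(x), tau(x) of the invariants; its
    coordinates are explicit rational functions of zeta(x), tau(x)
    ([normal_form]).  An invariant F = N / D takes the same value at x and at
    nu(x), that is N(nu(x)) D(x) = N(x) D(nu(x)) for all generic real x, hence
    as rational functions.  As nu(x0) = x0, choosing x0 with D(x0) != 0 makes
    D(nu) a nonzero rational function, and F = N(nu) / D(nu) belongs to
    R(zeta, tau) ([invariant_adjoin]).

    The invariants of [normal_form] x0 z are z, for any z with nonzero zeta_12
    and tau.  So zeta and tau take a Zariski dense set of values, which makes
    them algebraically independent ([generators_independent]).

    Identities between rational functions are passed to and from real points
    with [has_value], the evaluation on the local ring of a point. *)

Set Implicit Arguments.
Unset Strict Implicit.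
Unset Printing Implicit Defensive.

Import GRing.Theory Num.Theory.
Local Open Scope ring_scope.

(** * Values of polynomials and of rational functions at real points *)

Lemma poly_nonroot (R : numDomainType) (p : {poly R}) :
  p != 0 -> exists x, p.[x] != 0.
Proof.
move=> p0; pose s := [seq i%:R : R | i <- iota 0 (size p)].
have us : uniq s by rewrite map_inj_uniq ?iota_uniq //; exact: mulrIn (oner_neq0 _).
have : ~~ all (root p) s.
  by apply/negP => /(max_poly_roots p0)/(_ us); rewrite size_map size_iota ltnn.
by move=> /allPn[x _ px]; exists x.
Qed.

(** Induction on the number of variables: some coefficient of p, as a polynomial
    in the last variable, has a nonroot, which leaves one variable. *)
Lemma mpoly_nonroot (R : numDomainType) n (p : {mpoly R[n]}) :
  p != 0 -> exists x : 'I_n -> R, p.@[x] != 0.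
Proof.
elim: n p => [|n IHn] p p0.
  exists (fun=> 0); apply: contraNneq p0 => px; apply/eqP/mpolyP => m.
  rewrite mcoeff0 -[RHS]px mevalE.
  have m0 m' : m' = 0%MM :> 'X_{1..0} by apply/mnmP; case.
  rewrite (m0 m).
  have := msupp_uniq p; case: (msupp p) (mcoeff_msupp p) => [|a [|b s]] sp.
  - by rewrite big_nil => _; apply/eqP/negPn; rewrite -sp.
  - by rewrite big_seq1 big_ord0 mulr1 (m0 a).
  - by rewrite /= (m0 a) (m0 b) inE eqxx.
have [m mp] : exists m, m \in msupp p.
  move: p0; rewrite -msupp_eq0; case: (msupp p) => // m s _; exists m.
  by rewrite inE eqxx.
(* trunc m is the exponent of m in all the variables but the last one. *)
pose trunc (m : 'X_{1..n.+1}) :=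
  [multinom m (widen_ord (leqnSn n) i) | i < n].
have coef : (muni p)`_(m ord_max) @_ (trunc m) = p@_m.
  rewrite muniE coef_sum raddf_sum /= (bigD1_seq m) ?msupp_uniq //= big1 ?addr0.
    by rewrite coefZ coefXn eqxx mulr1 mcoeffZ mcoeffX eqxx mulr1.
  move=> m' ne; rewrite coefZ coefXn.
  have [E1|_] := eqVneq (m ord_max) (m' ord_max); last by rewrite mulr0 mcoeff0.
  rewrite mulr1 mcoeffZ mcoeffX; case: eqP => [E2|]; last by rewrite mulr0.
  case/eqP: ne; apply/mnmP => i; case: (unliftP ord_max i) => [j ->|->] //.
  have := congr1 (fun u : 'X_{1..n} => u j) E2; rewrite !mnmE.
  by rewrite (_ : widen_ord _ _ = lift ord_max j) //; apply/val_inj/esym/lift_max.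
have c0 : (muni p)`_(m ord_max) != 0.
  by apply: contraTneq mp => c0; rewrite mcoeff_msupp -coef c0 mcoeff0 eqxx.
have [y y0] := IHn _ c0.
have q0 : map_poly (meval y) (muni p) != 0.
  by apply: contraNneq y0 => q0; rewrite -coef_map /= q0 coef0.
have [t t0] := poly_nonroot q0.
exists (fun i => if unlift ord_max i is Some j then y j else t).
apply: contraNneq t0 => <-; apply/eqP.
rewrite mevalE muniE raddf_sum /= horner_sum; apply: eq_bigr => m' _.
rewrite map_polyZ /= map_polyXn mevalZ mevalX hornerZ hornerXn -mulrA.
congr (_ * _); rewrite big_ord_recr /= unlift_none; congr (_ * _).
apply: eq_bigr => j _; rewrite mnmE (_ : widen_ord _ _ = lift ord_max j) ?liftK //.
by apply/val_inj/esym/lift_max.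
Qed.

(** The denominator stays on the left of both equations, so that no case with a
    zero denominator arises. *)
Definition has_value (R : realType) m (x : 'I_m -> R) (F : ratfun R m) (c : R) :=
  exists N D : {mpoly R[m]},
    [/\ D.@[x] != 0, F * tofrac D = tofrac N & N.@[x] = c * D.@[x]].

Section Values.
Variables (R : realType) (m : nat).
Implicit Types (x : 'I_m -> R) (F G : ratfun R m).

Lemma has_value_poly x (P : {mpoly R[m]}) : has_value x (tofrac P) P.@[x].
Proof. by exists P, 1; rewrite meval1 oner_neq0 tofrac1 !mulr1. Qed.

Lemma has_valueC x c : has_value x (ratC m c) c.
Proof. by have := has_value_poly x c%:MP; rewrite mevalC. Qed.

Lemma has_valueX x k : has_value x (ratX R k) (x k).
Proof. by have := has_value_poly x 'X_k; rewrite mevalXU. Qed.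

Lemma has_valueD x F G c d :
  has_value x F c -> has_value x G d -> has_value x (F + G) (c + d).
Proof.
move=> [N [D [D0 E V]]] [N' [D' [D0' E' V']]].
exists (N * D' + N' * D), (D * D'); split.
- by rewrite mevalM mulf_neq0.
- by rewrite tofracD !tofracM -E -E'; ring.
- by rewrite mevalD !mevalM V V'; ring.
Qed.

Lemma has_valueM x F G c d :
  has_value x F c -> has_value x G d -> has_value x (F * G) (c * d).
Proof.
move=> [N [D [D0 E V]]] [N' [D' [D0' E' V']]].
exists (N * N'), (D * D'); split.
- by rewrite mevalM mulf_neq0.
- by rewrite !tofracM -E -E'; ring.
- by rewrite !mevalM V V'; ring.
Qed.

Lemma has_valueN x F c : has_value x F c -> has_value x (- F) (- c).
Proof.
move=> [N [D [D0 E V]]]; exists (- N), D; split=> //.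
- by rewrite tofracN -E; ring.
- by rewrite mevalN V; ring.
Qed.

Lemma has_valueB x F G c d :
  has_value x F c -> has_value x G d -> has_value x (F - G) (c - d).
Proof. by move=> Fc Gd; apply: has_valueD => //; apply: has_valueN. Qed.

Lemma has_valueV x F c : c != 0 -> has_value x F c -> has_value x F^-1 c^-1.
Proof.
move=> c0 [N [D [D0 E V]]].
have N0 : N.@[x] != 0 by rewrite V mulf_neq0.
have F0 : F != 0.
  apply: contraNneq N0 => F0; move: E; rewrite F0 mul0r => /esym/eqP.
  by rewrite tofrac_eq0 => /eqP ->; rewrite meval0.
by exists D, N; split=> //; rewrite -?E ?V mulKf.
Qed.

Lemma has_value_div x F G c d : d != 0 ->
  has_value x F c -> has_value x G d -> has_value x (F / G) (c / d).
Proof. by move=> d0 Fc Gd; apply: has_valueM => //; apply: has_valueV. Qed.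

Lemma has_value_uniq x F c d : has_value x F c -> has_value x F d -> c = d.
Proof.
move=> [N [D [D0 E V]]] [N' [D' [D0' E' V']]].
have /eqP : tofrac (N * D') = tofrac (N' * D) by rewrite !tofracM -E -E'; ring.
rewrite tofrac_eq => /eqP /(congr1 (meval x)); rewrite !mevalM V V' => e.
apply/(mulIf D0)/(mulIf D0'); rewrite e; ring.
Qed.

Lemma has_value_subst x k (v : 'I_k -> ratfun R m) (y : 'I_k -> R) P :
  (forall j, has_value x (v j) (y j)) -> has_value x (poly_subst v P) P.@[y].
Proof.
move=> vy; rewrite mevalE /poly_subst /mmap.
have has_value0 : has_value x 0 0.
  by have := has_value_poly x 0; rewrite meval0 tofrac0.
have has_value1 : has_value x 1 1.
  by have := has_value_poly x 1; rewrite meval1 tofrac1.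
elim/big_ind2: _ => // [F c G d|e _]; first exact: has_valueD.
apply: has_valueM; first exact: has_valueC.
rewrite /mmap1; elim/big_ind2: _ => // [F c G d|j _]; first exact: has_valueM.
elim: (e j) => [|i IHi]; first by rewrite !expr0.
by rewrite !exprS; apply: has_valueM.
Qed.

Lemma fraction_of F : exists N D : {mpoly R[m]}, D != 0 /\ F = tofrac N / tofrac D.
Proof.
have numden (x : {ratio {mpoly R[m]}}) :
    tofrac \n_x = \pi_(ratfun R m)%qT x * tofrac \d_x.
  unlock tofrac; rewrite -[RHS]FracField.pi_mul; apply/eqmodP => /=.
  rewrite FracField.equivfE /FracField.mulf.
  by rewrite !numden_Ratio ?mulf_neq0 ?oner_neq0 ?denom_ratioP // mulr1 mul1r.
have d0 := denom_ratioP (repr F).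
exists \n_(repr F), \d_(repr F); split=> //.
by rewrite numden reprK mulfK // tofrac_eq0.
Qed.

(** The points where neither E nor the numerator of a nonzero F vanishes are
    dense, and F cannot be defined and zero at such a point. *)
Lemma eq0_has_value (E : {mpoly R[m]}) F : E != 0 ->
  (forall x, E.@[x] != 0 -> has_value x F 0) -> F = 0.
Proof.
move=> E0 Fx0; have [N [D [D0 FE]]] := fraction_of F.
apply/eqP/negPn/negP => F0.
have N0 : N != 0 by apply: contraNneq F0 => N0; rewrite FE N0 tofrac0 mul0r.
have [|x] := @mpoly_nonroot R m (N * E); first by rewrite mulf_neq0.
rewrite mevalM mulf_eq0 negb_or => /andP[Nx /Fx0 [N' [D' [Dx' FE' Nx']]]].
have /eqP : tofrac (N * D') = tofrac (N' * D).
  by rewrite !tofracM -FE' FE mulrAC divfK ?tofrac_eq0 // mulrAC.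
rewrite tofrac_eq => /eqP /(congr1 (meval x)); rewrite !mevalM Nx' !mul0r => /eqP.
by rewrite mulf_eq0 (negbTE Nx) (negbTE Dx').
Qed.
End Values.

(** * The projective action in homogeneous coordinates *)

(** Configurations are taken in any commutative ring L: real points, the generic point
    [@ratX R _] whose coordinates are the variables, and its images under the
    projective maps are all treated at once. *)
Section Jets.
Variables (L : comUnitRingType) (n : nat).
Implicit Types (v : 'I_(n * 4) -> L) (T : 'M[L]_3).

Definition coord v (i : 'I_n) (c : 'I_4) : L := v (mxvec_index i c).

Definition point v i : 'cV[L]_3 :=
  \col_r (if r == 0 then coord v i cx else if r == 1 then coord v i cy else 1).

Definition covector v k : 'rV[L]_3 :=
  \row_r (if r == 0 then coord v k cp else if r == 1 then coord v k cq
          else - (coord v k cx * coord v k cp + coord v k cy * coord v k cq)).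

Definition phi v (k i j : 'I_n) : L :=
  (coord v i cx - coord v j cx) * coord v k cp
  + (coord v i cy - coord v j cy) * coord v k cq.

Definition weight T v i : L := (T *m point v i) 2%:R 0.

Definition moved_covector T v i : 'rV[L]_3 :=
  weight T v i *: (covector v i *m invmx T).

(** The prolongation in closed form, P_i -> w_i P_i T^-1; see [act_proj_act]. *)
Definition proj_act T v (k : 'I_(n * 4)) : L :=
  mxvec (\matrix_(i < n, c < 4)
    if c == cx then (T *m point v i) 0 0 / weight T v i
    else if c == cy then (T *m point v i) 1 0 / weight T v i
    else if c == cp then moved_covector T v i 0 0
    else moved_covector T v i 0 1) 0 k.

Lemma sum3 (F : 'I_3 -> L) : \sum_r F r = F 0 + F 1 + F 2%:R.
Proof.
rewrite !big_ord_recl big_ord0 addr0 addrA; congr (F _ + F _ + F _);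
  exact/val_inj.
Qed.

Lemma coord_eq v v' : (forall i c, coord v i c = coord v' i c) -> v =1 v'.
Proof. by move=> E k; case/mxvec_indexP: k => i c; apply: E. Qed.

Lemma phiE v k i j : phi v k i j = (covector v k *m (point v i - point v j)) 0 0.
Proof. by rewrite mxE sum3 !mxE /phi /=; ring. Qed.

Lemma covector_point v k : (covector v k *m point v k) 0 0 = 0.
Proof. by rewrite mxE sum3 !mxE /=; ring. Qed.

Lemma phi_self v k i : phi v k i k = (covector v k *m point v i) 0 0.
Proof.
by rewrite phiE mulmxBr mxE [X in _ + X]mxE covector_point subr0.
Qed.

(** The pairing of w_k P_k T^-1 with T X_i / w_i - T X_j / w_j; the last entry
    of the row does not contribute, since the difference of columns ends with
    0. *)
Lemma phi_moved T v k i j :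
    T \in unitmx -> weight T v i \is a GRing.unit ->
    weight T v j \is a GRing.unit ->
  phi (proj_act T v) k i j =
    weight T v k * (phi v k i k / weight T v i - phi v k j k / weight T v j).
Proof.
move=> uT ui uj; pose h i := (weight T v i)^-1 *: (T *m point v i).
(* h i is T X_i / w_i, whose entries are the new coordinates followed by 1. *)
have hE l : weight T v l \is a GRing.unit ->
    [/\ h l 0 0 = coord (proj_act T v) l cx, h l 1 0 = coord (proj_act T v) l cy
      & h l 2%:R 0 = 1].
  move=> ul; have hr r : h l r 0 = (T *m point v l) r 0 / weight T v l.
    by rewrite mxE mulrC.
  rewrite !hr /coord /proj_act !mxvecE; split; last by rewrite divrr.
  - by rewrite [RHS]mxE.
  - by rewrite [RHS]mxE.
have [hi0 hi1 hi2] := hE i ui; have [hj0 hj1 hj2] := hE j uj.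
transitivity ((moved_covector T v k *m (h i - h j)) 0 0).
  rewrite /phi -hi0 -hi1 -hj0 -hj1 [RHS]mxE sum3.
  have -> : coord (proj_act T v) k cp = moved_covector T v k 0 0.
    by rewrite /coord /proj_act mxvecE mxE.
  have -> : coord (proj_act T v) k cq = moved_covector T v k 0 1.
    by rewrite /coord /proj_act mxvecE mxE.
  move: (h i) (h j) hi2 hj2 => hi hj hi2 hj2.
  have hB r : (hi - hj) r 0 = hi r 0 - hj r 0 by rewrite 2!mxE.
  by rewrite !hB hi2 hj2; ring.
rewrite /moved_covector /h -scalemxAl mxE; congr (_ * _).
rewrite mulmxBr mxE [X in _ + X]mxE -!scalemxAr.
rewrite -!mulmxA !(mulmxA (invmx T)) !mulVmx // !mul1mx.
by rewrite mxE [X in _ - X]mxE -!phi_self 2![_^-1 * _]mulrC.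
Qed.
End Jets.

(** * The prolonged action of projective maps *)

HB.instance Definition _ (R : realType) m :=
  GRing.RMorphism.copy (@ratC R m) (@tofrac {mpoly R[m]} \o @mpolyC m R).

Local Notation wid := (widen_ord (leqnSn 2)).

Section ProjectiveDifferential.
Variable F : fieldType.

(* An entry of the product of the Jacobian and its inverse: (a0, a1, a2) is a
   row of the matrix, (m0, m1, m2) its last row, and (s0, s1, s2) a column of
   the inverse matrix. *)
Let jac_inv (a0 a1 a2 m0 m1 m2 x y s0 s1 s2 h w d : F) :
    h = a0 * x + a1 * y + a2 -> w = m0 * x + m1 * y + m2 -> w != 0 ->
    a0 * s0 + a1 * s1 + a2 * s2 = d -> m0 * s0 + m1 * s1 + m2 * s2 = 0 ->
  (a0 * w - h * m0) / w ^+ 2 * (w * (s0 - x * s2)) +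
  (a1 * w - h * m1) / w ^+ 2 * (w * (s1 - y * s2)) = d.
Proof.
move=> hE wE w0 <- m0E; rewrite -[RHS]subr0 -(mulr0 (h / w)) -m0E.
have -> : m2 = w - m0 * x - m1 * y by rewrite wE; ring.
by rewrite hE; field.
Qed.

(** With h = M (x, y, 1)^t and w its last entry, J is the Jacobian of the
    projective map of M at (x, y).  Its inverse is w E M^-1 C, where E has the
    rows (1, 0, - x) and (0, 1, - y) and C drops the last column. *)
Lemma covector_transport (M : 'M[F]_3) (J : 'M[F]_2) (x y w : F) (h : 'I_3 -> F)
    (g : 'rV[F]_2) (P : 'rV[F]_3) (c : 'I_2) :
    M \in unitmx -> w != 0 ->
    (forall r, h r = M r 0 * x + M r 1 * y + M r 2%:R) -> w = h 2%:R ->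
    (forall a b, J a b = (M (wid a) (wid b) * w - h (wid a) * M 2%:R (wid b))
                         / w ^+ 2) ->
    P 0 0 = g 0 0 -> P 0 1 = g 0 1 -> P 0 2%:R = - (x * g 0 0 + y * g 0 1) ->
  (g *m invmx J) 0 c = (w *: (P *m invmx M)) 0 (wid c).
Proof.
move=> uM w0 hE wE JE P0 P1 P2; set S := invmx M.
pose J' : 'M[F]_2 := \matrix_(b, d)
  (w * (S (wid b) (wid d) - (if b == 0 then x else y) * S 2%:R (wid d))).
have wid0 : wid 0 = 0 by apply: val_inj.
have wid1 : wid (lift 0 0) = 1 by apply: val_inj.
have JJ' : J *m J' = 1.
  apply/matrixP => a d; rewrite !mxE 2!big_ord_recl big_ord0 addr0 !JE !mxE /=.
  have MS (r s : 'I_3) :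
      M r 0 * S 0 s + M r 1 * S 1 s + M r 2%:R * S 2%:R s = (r == s)%:R.
    have := congr1 (fun A : 'M_3 => A r s) (mulmxV uM).
    by rewrite mxE sum3 => ->; rewrite mxE.
  rewrite wid0 wid1; apply: jac_inv => //.
  - by rewrite wE.
  - by rewrite MS; case: d => [[|[|//]]].
have [uJ _] := mulmx1_unit JJ'.
have -> : invmx J = J' by rewrite -[J'](mulKmx uJ) JJ' mulmx1.
rewrite mxE !big_ord_recl big_ord0 addr0 !mxE sum3 P0 P1 P2 wid0 wid1 /=.
rewrite (_ : lift _ _ = 1); last exact: val_inj.
ring.
Qed.
End ProjectiveDifferential.

Section Action.
Variables (R : realType) (n : nat) (T : 'M[R]_3).
Hypothesis unitT : T \in unitmx.
Implicit Type i : 'I_n.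
Local Notation X := (@ratX R (n * 4)).
Local Notation ratT := (map_mx (@ratC R (n * 4)) T).

Let H i (r : 'I_3) : {mpoly R[n * 4]} :=
  (T r 0)%:MP * 'X_(mxvec_index i cx) + (T r 1)%:MP * 'X_(mxvec_index i cy)
  + (T r 2%:R)%:MP.

Let HE i r : hom_image T i r = tofrac (H i r).
Proof. 
rewrite /H !tofracD !tofracM /hom_image.
by congr (ratC _ (T r _) * _ + ratC _ (T r _) * _ + ratC _ (T r _)); apply: val_inj.
Qed.

Lemma hom_imageE i r : hom_image T i r = (ratT *m point X i) r 0.
Proof.
rewrite mxE sum3 !mxE /= mulr1 /hom_image.
by congr (ratC _ (T r _) * _ + ratC _ (T r _) * _ + ratC _ (T r _)); apply: val_inj.
Qed.

Let mderivXX (k l : 'I_(n * 4)) :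
  mderiv k ('X_l : {mpoly R[n * 4]}) = (l == k)%:R.
Proof.
rewrite mderivX mnm1E; case: eqP => [->|_]; last by rewrite scale0r.
suff -> : (U_(k) - U_(k))%MM = 0%MM by rewrite mpolyX0 scale1r.
by apply/mnmP => j; rewrite mnmBE mnm0E subnn.
Qed.

Let cx_neq_cy i : (mxvec_index i cx == mxvec_index i cy) = false.
Proof. by apply/negP => /eqP /cast_ord_inj /enum_rank_inj []. Qed.

Let dHx i r : mderiv (mxvec_index i cx) (H i r) = (T r 0)%:MP.
Proof.
rewrite /H !mderivD !mderivM !mderivC !mderivXX eqxx eq_sym cx_neq_cy.
by rewrite !mul0r !mulr0 mulr1 !add0r !addr0.
Qed.

Let dHy i r : mderiv (mxvec_index i cy) (H i r) = (T r 1)%:MP.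
Proof.
rewrite /H !mderivD !mderivM !mderivC !mderivXX eqxx cx_neq_cy.
by rewrite !mul0r !mulr0 mulr1 !add0r !addr0.
Qed.

(** If the polynomial T_20 x_i + T_21 y_i + T_22 were zero, T would have a zero
    row. *)
Lemma weight_neq0 i : weight ratT X i != 0.
Proof.
rewrite /weight -hom_imageE HE tofrac_eq0; apply/eqP => H0.
have inj := can_inj (@mpolyCK (n * 4) R).
have T0 : T 2%:R 0 = 0 by apply: inj; rewrite -(dHx i) H0 mderiv0.
have T1 : T 2%:R 1 = 0 by apply: inj; rewrite -(dHy i) H0 mderiv0.
have T2 : T 2%:R 2%:R = 0.
  by apply: inj; rewrite -[RHS]H0 /H T0 T1 mpolyC0 !mul0r !add0r.
suff : delta_mx 0 2%:R = 0 :> 'rV[R]_3.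
  by move/matrixP/(_ 0 2%:R); rewrite !mxE eqxx /= => /eqP; rewrite oner_eq0.
apply: (can_inj (mulmxK unitT)); rewrite mul0mx -rowE.
apply/rowP => j; rewrite !mxE.
case: j => [[|[|[|//]]] jP].
- by rewrite -[RHS]T0; congr (T _ _); apply: val_inj.
- by rewrite -[RHS]T1; congr (T _ _); apply: val_inj.
- by rewrite -[RHS]T2; congr (T _ _); apply: val_inj.
Qed.

Lemma jacobianE i a b : jacobian T i a b =
  (ratT (wid a) (wid b) * hom_image T i 2%:R
   - hom_image T i (wid a) * ratT 2%:R (wid b)) / hom_image T i 2%:R ^+ 2.
Proof.
have H2 : H i 2%:R != 0.
  by have := weight_neq0 i; rewrite /weight -hom_imageE HE tofrac_eq0.
have dH s : mderiv (mxvec_index i (if b == 0 then cx else cy)) (H i s) =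
    (T s (wid b))%:MP.
  case: b => [[|[|//]]] bP /=; rewrite (dHx, dHy).
    by rewrite (_ : wid _ = 0); last exact: val_inj.
  by rewrite (_ : wid _ = 1); last exact: val_inj.
have pdE r : pderiv (mxvec_index i (if b == 0 then cx else cy))
    (hom_image T i r / hom_image T i 2%:R) =
  (ratT r (wid b) * hom_image T i 2%:R - hom_image T i r * ratT 2%:R (wid b))
  / hom_image T i 2%:R ^+ 2.
  by rewrite !HE pderiv_frac // !dH tofracXn tofracB !tofracM !mxE.
rewrite -pdE mxE /xt /yt.
have e (j j' : 'I_3) : j = j' :> nat -> j = j' by exact: val_inj.
rewrite (e (@Ordinal 3 2 isT) 2%:R erefl); case: a => [[|[|//]]] aP /=.
  by rewrite (e (@Ordinal 3 0 isT) (wid (Ordinal aP)) erefl).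
by rewrite (e (@Ordinal 3 1 isT) (wid (Ordinal aP)) erefl).
Qed.

Lemma gradtE i c : gradt T i 0 c = moved_covector ratT X i 0 (wid c).
Proof.
apply: (@covector_transport _ ratT (jacobian T i) (coord X i cx) (coord X i cy)
  (weight ratT X i) (hom_image T i)).
- by rewrite map_unitmx.
- exact: weight_neq0.
- by move=> r; rewrite hom_imageE mxE sum3 ![point _ _ _ _]mxE /= mulr1.
- by rewrite hom_imageE.
- by move=> a b; rewrite jacobianE /weight -hom_imageE.
- by rewrite !mxE.
- by rewrite !mxE.
- by rewrite !mxE.
Qed.

Lemma act_proj_act k : @act R n T k = proj_act ratT X k.
Proof.
rewrite /act /proj_act; congr (mxvec _ 0 k); apply/matrixP => i c.
rewrite mxE [RHS]mxE mxE /xt /yt !hom_imageE !gradtE /weight.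
have e (j j' : 'I_3) : j = j' :> nat -> j = j' by exact: val_inj.
rewrite (e (@Ordinal 3 0 isT) 0 erefl) (e (@Ordinal 3 1 isT) 1 erefl).
by rewrite (e (@Ordinal 3 2 isT) 2%:R erefl) (e (wid 0) 0 erefl) (e (wid 1) 1 erefl).
Qed.
End Action.

(** * The invariance of the generators *)

(** At the generic point these are [generators]; over other rings they give the
    values of the generators. *)
Definition invariants (L : comUnitRingType) (v : 'I_(3 * 4) -> L) (j : 'I_4) : L :=
  tnth [tuple phi v pt1 pt1 pt2 * phi v pt2 pt1 pt2;
              phi v pt2 pt2 pt3 * phi v pt3 pt2 pt3;
              phi v pt1 pt1 pt3 * phi v pt3 pt1 pt3;
              phi v pt1 pt1 pt3 * phi v pt3 pt2 pt3 * phi v pt2 pt1 pt2] j.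

Lemma ord4_ind (P : 'I_4 -> Prop) : P 0 -> P 1 -> P 2%:R -> P 3%:R -> forall j, P j.
Proof.
move=> P0 P1 P2 P3 [[|[|[|[|//]]]] jP].
- by rewrite (_ : Ordinal _ = 0) //; apply: val_inj.
- by rewrite (_ : Ordinal _ = 1) //; apply: val_inj.
- by rewrite (_ : Ordinal _ = 2%:R) //; apply: val_inj.
- by rewrite (_ : Ordinal _ = 3%:R) //; apply: val_inj.
Qed.

Lemma rmorph_invariants (L L' : comUnitRingType) (f : {rmorphism L -> L'}) v j :
  f (invariants v j) = invariants (fun k => f (v k)) j.
Proof.
have fphi k i l : f (phi v k i l) = phi (fun k => f (v k)) k i l.
  by rewrite /phi rmorphD !rmorphM !rmorphB.
by elim/ord4_ind: j; rewrite /invariants !(tnth_nth 0) /= !rmorphM !fphi.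
Qed.

Section FieldAction.
Variables (L : fieldType) (T : 'M[L]_3) (unitT : T \in unitmx).

Lemma phi_moved_self n (v : 'I_(n * 4) -> L) k j :
    weight T v k != 0 -> weight T v j != 0 ->
  phi (proj_act T v) k k j = weight T v k / weight T v j * phi v k k j.
Proof.
move=> wk wj; rewrite phi_moved ?unitfE //.
by rewrite /phi; field; rewrite wk wj.
Qed.

Lemma phi_movedC n (v : 'I_(n * 4) -> L) k j :
    weight T v k != 0 -> weight T v j != 0 ->
  phi (proj_act T v) k j k = weight T v k / weight T v j * phi v k j k.
Proof.
move=> wk wj; rewrite phi_moved ?unitfE //.
by rewrite /phi; field; rewrite wk wj.
Qed.

(** In each product the weights run along a cycle of indices and cancel. *)
Lemma invariants_moved (v : 'I_(3 * 4) -> L) j :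
  (forall i, weight T v i != 0) -> invariants (proj_act T v) j = invariants v j.
Proof.
move=> w0; elim/ord4_ind: j; rewrite /invariants !(tnth_nth 0) /=;
  rewrite !(phi_moved_self, phi_movedC) //; field; by rewrite !w0.
Qed.
End FieldAction.

HB.instance Definition _ (R : realType) k m (v : 'I_k -> ratfun R m) :=
  GRing.RMorphism.copy (poly_subst v) (mmap (@ratC R m) v).

Section Invariance.
Variable R : realType.

Lemma poly_substX k m (v : 'I_k -> ratfun R m) i : poly_subst v 'X_i = v i.
Proof. by rewrite /poly_subst mmapX mmap1U. Qed.

Lemma generators_invariant j : abs_invariant (generators R j).
Proof.
move=> T uT; exists (invariants (fun k => 'X_k) j), 1.
rewrite !rmorph1 oner_neq0 !divr1; split=> //.
  by rewrite rmorph_invariants.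
transitivity (invariants (@act R 3 T) j); last first.
  rewrite rmorph_invariants.
  by congr (invariants _ j); apply/funext => k; rewrite [RHS]poly_substX.
have -> : @act R 3 T = proj_act (map_mx (@ratC R (3 * 4)) T) (@ratX R (3 * 4)).
  by apply/funext => k; rewrite act_proj_act.
rewrite invariants_moved ?map_unitmx //; exact: weight_neq0.
Qed.

(** The fraction provided by [rat_subst] may depend on the substitution; this
    trades it for a fraction fixed beforehand. *)
Lemma rat_subst_cross k m (v : 'I_k -> ratfun R m) F G N D :
    D != 0 -> F = tofrac N / tofrac D -> rat_subst v F G ->
  poly_subst v N = G * poly_subst v D.
Proof.
move=> D0 FE [N' [D' [FE' D'v ->]]].
have D'0 : D' != 0 by apply: contraNneq D'v => ->; rewrite (rmorph0 (poly_subst v)).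
have /eqP : tofrac N * tofrac D' = tofrac N' * tofrac D.
  by have := FE'; rewrite FE => /eqP; rewrite eqr_div ?tofrac_eq0 // => /eqP.
rewrite -!tofracM tofrac_eq => /eqP /(congr1 (poly_subst v)).
rewrite !(rmorphM (poly_subst v)) => E.
by apply: (mulIf D'v); rewrite E mulrAC divfK.
Qed.

Lemma subf_div (L : fieldType) (a b c d : L) :
  b != 0 -> d != 0 -> a / b - c / d = (a * d - c * b) / (b * d).
Proof. by move=> b0 d0; rewrite -mulNr addf_div // mulNr. Qed.

Lemma poly_subst_neq0 k m (v : 'I_k -> ratfun R m) D :
  poly_subst v D != 0 -> D != 0.
Proof. by apply: contraNneq => ->; rewrite (rmorph0 (poly_subst v)). Qed.

Lemma rat_substB k m (v : 'I_k -> ratfun R m) F F' G G' :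
  rat_subst v F F' -> rat_subst v G G' -> rat_subst v (F - G) (F' - G').
Proof.
move=> [N [D [-> Dv ->]]] [N' [D' [-> D'v ->]]].
exists (N * D' - N' * D), (D * D'); split.
- rewrite tofracB !tofracM subf_div // tofrac_eq0; first exact: poly_subst_neq0 Dv.
  exact: poly_subst_neq0 D'v.
- rewrite (rmorphM (poly_subst v)); exact: (mulf_neq0 Dv D'v).
- rewrite (rmorphB (poly_subst v)) !(rmorphM (poly_subst v)).
  exact: (subf_div _ _ Dv D'v).
Qed.

Lemma rat_subst_div k m (v : 'I_k -> ratfun R m) F F' G G' : G' != 0 ->
  rat_subst v F F' -> rat_subst v G G' -> rat_subst v (F / G) (F' / G').
Proof.
move=> G'0 [N [D [-> Dv ->]]] [N' [D' [-> D'v G'E]]].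
have N'v : poly_subst v N' != 0.
  by apply: contraNneq G'0 => N'0; rewrite G'E N'0 mul0r.
exists (N * D'), (D * N'); split.
- by rewrite !tofracM invf_div mulf_div.
- rewrite (rmorphM (poly_subst v)); exact: (mulf_neq0 Dv N'v).
- by rewrite G'E !(rmorphM (poly_subst v)) invf_div mulf_div.
Qed.

Lemma rat_substC k m (v : 'I_k -> ratfun R m) c : rat_subst v (ratC k c) (ratC m c).
Proof.
exists c%:MP, 1; split; first by rewrite rmorph1 divr1.
  by rewrite (rmorph1 (poly_subst v)) oner_neq0.
by rewrite (rmorph1 (poly_subst v)) divr1 /poly_subst mmapC.
Qed.

Lemma abs_invariant_divring (n : nat) :
  GRing.divring_closed [pred F : jetfun R n | `[< abs_invariant F >]].
Proof.
split=> [|F G /asboolP invF /asboolP invG|F G /asboolP invF /asboolP invG];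
  apply/asboolP => T uT.
- by have := rat_substC (@act R n T) 1; rewrite !(rmorph1 (@ratC R _)).
- exact: rat_substB (invF T uT) (invG T uT).
- have [->|G0] := eqVneq G 0.
    rewrite invr0 mulr0.
    by have := rat_substC (@act R n T) 0; rewrite !(rmorph0 (@ratC R _)).
  exact: rat_subst_div (invF T uT) (invG T uT).
Qed.

Lemma ratC_invariant n c : abs_invariant (ratC (n * 4) c : jetfun R n).
Proof.
by move=> T _; exact: rat_substC.
Qed.

Lemma adjoin_invariant F : in_adjoin (generators R) F -> abs_invariant F.
Proof.
move=> /(_ _ (abs_invariant_divring 3)) inF; apply/asboolP/inF => [c|j].
  exact/asboolP/ratC_invariant.
exact/asboolP/generators_invariant.
Qed.
End Invariance.

(** * Generic configurations with the same invariants *)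

Definition area (L : comUnitRingType) (v : 'I_(3 * 4) -> L) : L :=
  (coord v pt1 cx - coord v pt2 cx) * (coord v pt1 cy - coord v pt3 cy)
  - (coord v pt1 cx - coord v pt3 cx) * (coord v pt1 cy - coord v pt2 cy).

(** A configuration is generic when this does not vanish: the points are not
    collinear, and the pairings that serve as denominators are nonzero. *)
Definition genericity (L : comUnitRingType) (v : 'I_(3 * 4) -> L) : L :=
  area v * invariants v 0 * invariants v 3%:R.

Lemma rmorph_genericity (L L' : comUnitRingType) (f : {rmorphism L -> L'}) v :
  f (genericity v) = genericity (fun k => f (v k)).
Proof. 
by rewrite /genericity 2!rmorphM 2!rmorph_invariants /area rmorphB !rmorphM !rmorphB. Qed.

Lemma ord3_ind (P : 'I_3 -> Prop) : P pt1 -> P pt2 -> P pt3 -> forall i, P i.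
Proof.
move=> P1 P2 P3 [[|[|[|//]]] iP].
- by rewrite (_ : Ordinal _ = pt1) //; apply: val_inj.
- by rewrite (_ : Ordinal _ = pt2) //; apply: val_inj.
- by rewrite (_ : Ordinal _ = pt3) //; apply: val_inj.
Qed.

Lemma coord_ind (P : 'I_4 -> Prop) : P cx -> P cy -> P cp -> P cq -> forall c, P c.
Proof.
move=> Px Py Pp Pq [[|[|[|[|//]]]] cP].
- by rewrite (_ : Ordinal _ = cx) //; apply: val_inj.
- by rewrite (_ : Ordinal _ = cy) //; apply: val_inj.
- by rewrite (_ : Ordinal _ = cp) //; apply: val_inj.
- by rewrite (_ : Ordinal _ = cq) //; apply: val_inj.
Qed.

Section NormalForm.
Variable L : fieldType.
Implicit Types (v : 'I_(3 * 4) -> L) (z : 'I_4 -> L).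

Lemma generic_invariants v : genericity v != 0 ->
  invariants v 0 != 0 /\ invariants v 3%:R != 0.
Proof.
by rewrite /genericity !mulf_eq0 !negb_or => /andP[/andP[_ ->] ->].
Qed.

Lemma genericP v : genericity v != 0 ->
  [/\ area v != 0, phi v pt1 pt1 pt2 != 0, phi v pt1 pt1 pt3 != 0,
      phi v pt2 pt1 pt2 != 0 & phi v pt3 pt2 pt3 != 0].
Proof.
rewrite /genericity /invariants !(tnth_nth 0) /= !mulf_eq0 !negb_or.
by move=> /andP[/andP[-> /andP[-> _]] /andP[/andP[-> ->] ->]].
Qed.

Definition frame v : 'M[L]_3 := \matrix_(r, i) point v i r 0.

Lemma det_frame v : \det (frame v) = area v.
Proof.
rewrite (expand_det_row _ 0) sum3 /cofactor.
rewrite !(expand_det_row _ 0) !big_ord_recl !big_ord0 /cofactor !det_mx11 !mxE /=.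
pose X a := coord v (inord a) cx; pose Y a := coord v (inord a) cy.
have XE j : coord v j cx = X j by rewrite /X inord_val.
have YE j : coord v j cy = Y j by rewrite /Y inord_val.
by rewrite /area !XE !YE /= /bump /=; ring.
Qed.

(** Two pairings with independent directions determine each gradient. *)
Lemma jet_eq v v' : area v != 0 ->
    (forall i, coord v i cx = coord v' i cx) ->
    (forall i, coord v i cy = coord v' i cy) ->
    phi v pt1 pt1 pt2 = phi v' pt1 pt1 pt2 ->
    phi v pt1 pt1 pt3 = phi v' pt1 pt1 pt3 ->
    phi v pt2 pt1 pt2 = phi v' pt2 pt1 pt2 ->
    phi v pt2 pt2 pt3 = phi v' pt2 pt2 pt3 ->
    phi v pt3 pt1 pt3 = phi v' pt3 pt1 pt3 ->
    phi v pt3 pt2 pt3 = phi v' pt3 pt2 pt3 ->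
  v =1 v'.
Proof.
move=> v0 vx vy; rewrite /phi -!vx -!vy => e112 e113 e212 e223 e313 e323.
(* A 2 x 2 linear system with determinant [area v] has at most one solution. *)
have cramer (a b c d p q p' q' : L) : a * d - c * b = area v ->
    a * p + b * q = a * p' + b * q' -> c * p + d * q = c * p' + d * q' ->
    p = p' /\ q = q'.
  move=> E e1 e2; split; apply/(mulfI v0); rewrite -E; apply/eqP.
    rewrite -subr_eq0 (_ : _ - _ = d * (a * p + b * q - (a * p' + b * q'))
      - b * (c * p + d * q - (c * p' + d * q'))); last by ring.
    by rewrite e1 e2 !subrr !mulr0 subrr.
  rewrite -subr_eq0 (_ : _ - _ = a * (c * p + d * q - (c * p' + d * q'))
    - c * (a * p + b * q - (a * p' + b * q'))); last by ring.
  by rewrite e1 e2 !subrr !mulr0 subrr.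
apply: coord_eq => i.
have [p q] : coord v i cp = coord v' i cp /\ coord v i cq = coord v' i cq.
  elim/ord3_ind: i.
  - by apply: cramer e112 e113; rewrite /area; ring.
  - by apply: cramer e212 e223; rewrite /area; ring.
  - by apply: cramer e313 e323; rewrite /area; ring.
by elim/coord_ind.
Qed.

(** The configuration with the points of v, the values at v of the two [phi] at
    the first point, and the invariants z.  The definitions of the invariants
    give the other four [phi]; the gradient at the point i then solves, by
    Cramer's rule, the two linear equations with directions e, f and right-hand
    sides r, s.  The three systems have the same determinant [area v]. *)
Definition normal_form v z (k : 'I_(3 * 4)) : L :=
  let a12 := phi v pt1 pt1 pt2 in
  let a13 := phi v pt1 pt1 pt3 in
  let a21 := z 0 / a12 in
  let a31 := z 2%:R / a13 in
  let a32 := z 3%:R / (a13 * a21) in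
  let a23 := z 1 / a32 in
  mxvec (\matrix_(i < 3, c < 4)
    let: (e, f, r, s) :=
      if i == pt1 then ((pt1, pt2), (pt1, pt3), a12, a13)
      else if i == pt2 then ((pt1, pt2), (pt2, pt3), a21, a23)
      else ((pt1, pt3), (pt2, pt3), a31, a32) in
    if c == cx then coord v i cx
    else if c == cy then coord v i cy
    else if c == cp then
      (r * (coord v f.1 cy - coord v f.2 cy)
       - s * (coord v e.1 cy - coord v e.2 cy)) / area v
    else
      (s * (coord v e.1 cx - coord v e.2 cx)
       - r * (coord v f.1 cx - coord v f.2 cx)) / area v) 0 k.

Lemma normal_form_x v z i : coord (normal_form v z) i cx = coord v i cx.
Proof. by rewrite [LHS]/coord /normal_form mxvecE mxE /=; elim/ord3_ind: i. Qed.

Lemma normal_form_y v z i : coord (normal_form v z) i cy = coord v i cy.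
Proof. by rewrite [LHS]/coord /normal_form mxvecE mxE /=; elim/ord3_ind: i. Qed.

Lemma phi_normal_form v z (u := normal_form v z) : area v != 0 ->
  [/\ phi u pt1 pt1 pt2 = phi v pt1 pt1 pt2
    , phi u pt1 pt1 pt3 = phi v pt1 pt1 pt3
    , phi u pt2 pt1 pt2 = z 0 / phi v pt1 pt1 pt2
    , phi u pt3 pt1 pt3 = z 2%:R / phi v pt1 pt1 pt3
    & phi u pt3 pt2 pt3 = z 3%:R / (phi v pt1 pt1 pt3 * (z 0 / phi v pt1 pt1 pt2))
    /\ phi u pt2 pt2 pt3 = z 1 / phi u pt3 pt2 pt3].
Proof.
move=> v0.
have cramer (a b c d r s : L) : a * d - c * b = area v ->
    a * ((r * d - s * b) / area v) + b * ((s * a - r * c) / area v) = r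
    /\ c * ((r * d - s * b) / area v) + d * ((s * a - r * c) / area v) = s.
  by move=> E; split; rewrite -E in v0 *; field.
have e1 : (coord v pt1 cx - coord v pt2 cx) * (coord v pt1 cy - coord v pt3 cy)
  - (coord v pt1 cx - coord v pt3 cx) * (coord v pt1 cy - coord v pt2 cy) = area v by [].
have e2 : (coord v pt1 cx - coord v pt2 cx) * (coord v pt2 cy - coord v pt3 cy)
  - (coord v pt2 cx - coord v pt3 cx) * (coord v pt1 cy - coord v pt2 cy) = area v.
  by rewrite /area; ring.
have e3 : (coord v pt1 cx - coord v pt3 cx) * (coord v pt2 cy - coord v pt3 cy)
  - (coord v pt2 cx - coord v pt3 cx) * (coord v pt1 cy - coord v pt3 cy) = area v.
  by rewrite /area; ring.
pose a21 := z 0 / phi v pt1 pt1 pt2; pose a31 := z 2%:R / phi v pt1 pt1 pt3.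
pose a32 := z 3%:R / (phi v pt1 pt1 pt3 * a21); pose a23 := z 1 / a32.
pose grad e f r s (i : 'I_3) := coord u i cp =
    (r * (coord v f.1 cy - coord v f.2 cy) - s * (coord v e.1 cy - coord v e.2 cy))
      / area v
  /\ coord u i cq =
    (s * (coord v e.1 cx - coord v e.2 cx) - r * (coord v f.1 cx - coord v f.2 cx))
      / area v.
have [p1 q1] : grad (pt1, pt2) (pt1, pt3) (phi v pt1 pt1 pt2) (phi v pt1 pt1 pt3) pt1.
  by split; rewrite [LHS]/coord /u /normal_form mxvecE mxE.
have [p2 q2] : grad (pt1, pt2) (pt2, pt3) a21 a23 pt2.
  by split; rewrite [LHS]/coord /u /normal_form mxvecE mxE.
have [p3 q3] : grad (pt1, pt3) (pt2, pt3) a31 a32 pt3.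
  by split; rewrite [LHS]/coord /u /normal_form mxvecE mxE.
have [c112 c113] := cramer _ _ _ _ (phi v pt1 pt1 pt2) (phi v pt1 pt1 pt3) e1.
have [c212 c223] := cramer _ _ _ _ a21 a23 e2.
have [c313 c323] := cramer _ _ _ _ a31 a32 e3.
have E323 : phi u pt3 pt2 pt3 = a32.
  by rewrite /phi !normal_form_x !normal_form_y p3 q3.
split; last by split=> //; rewrite E323 /phi !normal_form_x !normal_form_y p2 q2.
- by rewrite {1}/phi !normal_form_x !normal_form_y p1 q1.
- by rewrite {1}/phi !normal_form_x !normal_form_y p1 q1.
- by rewrite {1}/phi !normal_form_x !normal_form_y p2 q2.
- by rewrite {1}/phi !normal_form_x !normal_form_y p3 q3.
Qed.

Lemma invariants_normal_form v z : genericity v != 0 -> z 0 != 0 -> z 3%:R != 0 ->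
  invariants (normal_form v z) =1 z.
Proof.
move=> /genericP[v0 a120 a130 _ _] z00 z30.
have [c112 c113 c212 c313 [c323 c223]] := phi_normal_form z v0.
elim/ord4_ind; rewrite /invariants !(tnth_nth 0) /=
  ?(c223, c112, c113, c212, c313, c323).
- by field.
- by field; rewrite a120 z00 a130.
- by field.
- by field; rewrite a120 z00 a130.
Qed.

Lemma genericity_normal_form v z : genericity v != 0 -> z 0 != 0 -> z 3%:R != 0 ->
  genericity (normal_form v z) != 0.
Proof.
move=> gv z00 z30; rewrite /genericity !invariants_normal_form // !mulf_neq0 //.
rewrite /area !normal_form_x !normal_form_y -/(area v).
by have [] := genericP gv.
Qed.

Lemma normal_form_invariants v : genericity v != 0 ->
  normal_form v (invariants v) =1 v.
Proof.
move=> /genericP[v0 a120 a130 a210 a320].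
have [c112 c113 c212 c313 [c323 c223]] := phi_normal_form (invariants v) v0.
have E212 : phi (normal_form v (invariants v)) pt2 pt1 pt2 = phi v pt2 pt1 pt2.
  by rewrite c212 /invariants !(tnth_nth 0) /= mulrC mulKf.
have E323 : phi (normal_form v (invariants v)) pt3 pt2 pt3 = phi v pt3 pt2 pt3.
  by rewrite c323 -c212 E212 /invariants !(tnth_nth 0) /=; field; rewrite a210.
apply: jet_eq => //.
- by rewrite /area !normal_form_x !normal_form_y.
- exact: normal_form_x.
- exact: normal_form_y.
- by rewrite c223 E323 /invariants !(tnth_nth 0) /= mulfK.
- by rewrite c313 /invariants !(tnth_nth 0) /= mulrC mulKf.
Qed.

(** T is defined by T X_i = w_i X'_i.  The weights are normalized by w_1 = 1,
    and the two [phi] at the first point force w_2 and w_3; the equality of the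
    invariants then gives the other four. *)
Lemma same_orbit v v' : genericity v != 0 -> genericity v' != 0 ->
    invariants v =1 invariants v' ->
  exists2 T : 'M[L]_3, T \in unitmx &
    (forall i, weight T v i != 0) /\ proj_act T v =1 v'.
Proof.
move=> /genericP[v0 a120 a130 a210 a320] /genericP[v'0 b120 b130 b210 b320] E.
have := E 0; have := E 1; have := E 2%:R; have := E 3%:R.
rewrite /invariants !(tnth_nth 0) /= => E3 E2 E1 E0.
pose w (i : 'I_3) := if i == pt1 then 1 else
  phi v pt1 pt1 i / phi v' pt1 pt1 i.
have w0 i : w i != 0.
  by elim/ord3_ind: i; rewrite /w /= ?oner_neq0 // mulf_neq0 ?invr_eq0.
have uF : frame v \in unitmx by rewrite unitmxE unitfE det_frame.
have uF' : frame v' \in unitmx by rewrite unitmxE unitfE det_frame.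
pose T := frame v' *m diag_mx (\row_i w i) *m invmx (frame v).
have Tpoint i : T *m point v i = w i *: point v' i.
  have pointE (u : 'I_(3 * 4) -> L) j : point u j = col j (frame u).
    by apply/colP => r; rewrite [RHS]mxE [RHS]mxE.
  rewrite !pointE [in LHS]colE mulmxA mulmxKV // -colE; apply/colP => r.
  by rewrite mul_mx_diag !mxE mulrC.
have wE i : weight T v i = w i by rewrite /weight Tpoint !mxE /= mulr1.
have uT : T \in unitmx.
  rewrite !unitmx_mul uF' unitmx_inv uF andbT /= unitmxE det_diag unitfE.
  by apply/prodf_neq0 => i _; rewrite mxE.
have wv i : weight T v i != 0 by rewrite wE.
exists T => //; split=> //.
have xE i : coord (proj_act T v) i cx = coord v' i cx.
  by rewrite [LHS]mxvecE mxE /= wE Tpoint !mxE /= mulrC mulKf.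
have yE i : coord (proj_act T v) i cy = coord v' i cy.
  by rewrite [LHS]mxvecE mxE /= wE Tpoint !mxE /= mulrC mulKf.
(* tau determines this value, once zeta_12 has determined phi v' pt2 pt1 pt2. *)
have e323 : w pt3 / w pt2 * phi v pt3 pt2 pt3 = phi v' pt3 pt2 pt3.
  have nz : phi v' pt1 pt1 pt3 * phi v' pt2 pt1 pt2 != 0 by rewrite mulf_neq0.
  apply: (mulfI nz); rewrite [RHS]mulrAC -E3 /w /=.
  apply: (mulfI b120).
  transitivity (phi v pt1 pt1 pt3 * phi v pt3 pt2 pt3
      * (phi v' pt1 pt1 pt2 * phi v' pt2 pt1 pt2)
      * phi v' pt1 pt1 pt2 / phi v pt1 pt1 pt2).
    by field; rewrite a120 b130 b120.
  by rewrite -E0; field.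
apply: jet_eq => //.
- by rewrite /area !xE !yE.
- by rewrite phi_moved_self // !wE /w /=; field; rewrite a120 b120.
- by rewrite phi_moved_self // !wE /w /=; field; rewrite a130 b130.
- rewrite phi_movedC // !wE /w /=; apply: (mulfI b120); rewrite -E0.
  by field; rewrite oner_neq0 b120.
- rewrite phi_moved_self // !wE; apply: (mulIf b320); rewrite -E1 -e323.
  by field; rewrite !w0.
- rewrite phi_movedC // !wE /w /=; apply: (mulfI b130); rewrite -E2.
  by field; rewrite oner_neq0 b130.
- by rewrite phi_movedC // !wE.
Qed.

End NormalForm.

(** * Invariants as rational functions of the generators *)

Section JetValues.
Variable R : realType.

Lemma has_value_act n (T : 'M[R]_3) (x : 'I_(n * 4) -> R) k :
    T \in unitmx -> (forall i, weight T x i != 0) ->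
  has_value x (@act R n T k) (proj_act T x k).
Proof.
move=> uT w0; rewrite act_proj_act //.
(* ratv A B: the entries of A have the entries of B as values at x. *)
pose ratv m1 m2 (A : 'M[jetfun R n]_(m1, m2)) (B : 'M[R]_(m1, m2)) :=
  forall i j, has_value x (A i j) (B i j).
have ratvM m1 m2 m3 A B A' B' : @ratv m1 m2 A A' -> @ratv m2 m3 B B' ->
    ratv _ _ (A *m B) (A' *m B').
  move=> hA hB i j; rewrite !mxE.
  have has_value0 : has_value x 0 0.
    by have := has_valueC x 0; rewrite rmorph0.
  elim/big_ind2: _ => // [F c G d|l _]; first exact: has_valueD.
  exact: has_valueM.
have ratT (B : 'M[R]_3) : ratv _ _ (map_mx (@ratC R _) B) B.
  by move=> i j; rewrite mxE; exact: has_valueC.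
have hX l : has_value x (@ratX R (n * 4) l) (x l) by exact: has_valueX.
have hpoint i : ratv _ _ (point (@ratX R (n * 4)) i) (point x i).
  move=> r j; rewrite !mxE.
  case: ifP => _; first exact: hX.
  case: ifP => _; first exact: hX.
  by have := has_valueC x 1; rewrite rmorph1.
have hcov i : ratv _ _ (covector (@ratX R (n * 4)) i) (covector x i).
  move=> j r; rewrite !mxE.
  case: ifP => _; first exact: hX.
  case: ifP => _; first exact: hX.
  by apply/has_valueN/has_valueD; apply: has_valueM; exact: hX.
have hTp i := ratvM _ _ _ _ _ _ _ (ratT T) (hpoint i).
have hw i := hTp i 2%:R 0.
have hmoved i j : has_value x
    (moved_covector (map_mx (@ratC R _) T) (@ratX R (n * 4)) i 0 j)
    (moved_covector T x i 0 j).
  rewrite /moved_covector -map_invmx mxE [X in has_value _ _ X]mxE.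
  by apply: has_valueM; [exact: hw | exact: ratvM].
case/mxvec_indexP: k => i c; rewrite /proj_act !mxvecE mxE [X in has_value _ _ X]mxE.
case: ifP => _; first exact: has_value_div (w0 i) (hTp i 0 0) (hw i).
case: ifP => _; first exact: has_value_div (w0 i) (hTp i 1 0) (hw i).
by case: ifP => _; exact: hmoved.
Qed.

Lemma has_value_generators (x : 'I_(3 * 4) -> R) j :
  has_value x (generators R j) (invariants x j).
Proof.
have := has_value_poly x (invariants (fun k => 'X_k) j).
rewrite !rmorph_invariants.
rewrite (_ : (fun k => ('X_k : {mpoly R[3 * 4]}).@[x]) = x) //.
by apply/funext => k; rewrite mevalXU.
Qed.

Lemma has_value_normal_form (x0 x : 'I_(3 * 4) -> R) k :
    genericity x0 != 0 -> genericity x != 0 ->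
  has_value x (normal_form (fun l => ratC _ (x0 l)) (generators R) k)
    (normal_form x0 (invariants x) k).
Proof.
move=> g0 g; have [a0 a120 a130 _ _] := genericP g0.
have [z0 z3] := generic_invariants g.
have hz := has_value_generators x.
have hc i c : has_value x (coord (fun l => ratC _ (x0 l)) i c) (coord x0 i c).
  exact: has_valueC.
have harea : has_value x (area (fun l => ratC _ (x0 l))) (area x0).
  by rewrite /area; do !(apply: has_valueB || apply: has_valueM || apply: hc).
have hphi i j l : has_value x (phi (fun l => ratC _ (x0 l)) i j l) (phi x0 i j l).
  by apply: has_valueD; apply: has_valueM => //; apply: has_valueB.
have h21 := has_value_div a120 (hz 0) (hphi pt1 pt1 pt2).
have h31 := has_value_div a130 (hz 2%:R) (hphi pt1 pt1 pt3).
have h32 : has_value x _ _ :=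
  has_value_div (mulf_neq0 a130 (mulf_neq0 z0 (invr_neq0 a120)))
    (hz 3%:R) (has_valueM (hphi pt1 pt1 pt3) h21).
have h23 := has_value_div (mulf_neq0 z3 (invr_neq0
  (mulf_neq0 a130 (mulf_neq0 z0 (invr_neq0 a120))))) (hz 1) h32.
have hsolve r r' s s' i j l t c : has_value x r r' -> has_value x s s' ->
    has_value x
      ((r * (coord (fun l => ratC _ (x0 l)) i c - coord (fun l => ratC _ (x0 l)) j c)
        - s * (coord (fun l => ratC _ (x0 l)) l c - coord (fun l => ratC _ (x0 l)) t c))
       / area (fun l => ratC _ (x0 l)))
      ((r' * (coord x0 i c - coord x0 j c) - s' * (coord x0 l c - coord x0 t c))
       / area x0).
  move=> hr hs; apply: has_value_div a0 _ harea.
  by apply: has_valueB; apply: has_valueM => //; exact: has_valueB.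
case/mxvec_indexP: k => i c.
rewrite /normal_form !mxvecE mxE [X in has_value _ _ X]mxE.
by elim/ord3_ind: i; elim/coord_ind: c => /=; try exact: hc; exact: hsolve.
Qed.

Lemma meval_genericity (x : 'I_(3 * 4) -> R) :
  (genericity (fun k => 'X_k : {mpoly R[3 * 4]})).@[x] = genericity x.
Proof.
rewrite rmorph_genericity; congr genericity.
by apply/funext => k; exact: mevalXU.
Qed.
(** The witness has the points (0, 0), (1, 0), (0, 1), and gradients for which
    [area], zeta_12 and tau equal 1. *)
Lemma genericity_neq0 : genericity (fun k => 'X_k : {mpoly R[3 * 4]}) != 0.
Proof.
pose v k : R := mxvec (\matrix_(i < 3, c < 4)
  (nth [::] [:: [:: 0; 0; -1; -1]; [:: 1; 0; -1; 0]; [:: 0; 1; 1; 0]] i)`_c) 0 k.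
have g1 : genericity v = 1.
  rewrite /genericity /area /invariants !(tnth_nth 0) /= /phi /coord /v !mxvecE !mxE /=.
  by ring.
apply/eqP => /(congr1 (meval v)); rewrite meval_genericity g1 meval0.
by move/eqP; rewrite oner_eq0.
Qed.

End JetValues.

Section Adjoin.
Variables (R : realType) (k m : nat) (s : 'I_k -> ratfun R m).

Lemma adjoinC c : in_adjoin s (ratC m c).
Proof. by move=> S _ SC _; apply: SC. Qed.

Lemma adjoin_gen j : in_adjoin s (s j).
Proof. by move=> S _ _; apply. Qed.

Lemma adjoinB F G : in_adjoin s F -> in_adjoin s G -> in_adjoin s (F - G).
Proof. by move=> inF inG S dS SC Sg; have [_ SB _] := dS; apply: SB; auto. Qed.

Lemma adjoin_div F G : in_adjoin s F -> in_adjoin s G -> in_adjoin s (F / G).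
Proof. by move=> inF inG S dS SC Sg; have [_ _ SV] := dS; apply: SV; auto. Qed.

Lemma adjoinD F G : in_adjoin s F -> in_adjoin s G -> in_adjoin s (F + G).
Proof.
move=> inF inG; rewrite -[G]opprK -[- G]sub0r -(rmorph0 (@ratC R m)).
exact: adjoinB inF (adjoinB (adjoinC _) inG).
Qed.

Lemma adjoinM F G : in_adjoin s F -> in_adjoin s G -> in_adjoin s (F * G).
Proof.
move=> inF inG; rewrite -[G]invrK -[G^-1]div1r -(rmorph1 (@ratC R m)).
exact: adjoin_div inF (adjoin_div (adjoinC _) inG).
Qed.

Lemma adjoin_subst l (v : 'I_l -> ratfun R m) P :
  (forall j, in_adjoin s (v j)) -> in_adjoin s (poly_subst v P).
Proof.
move=> inv; rewrite /poly_subst /mmap.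
have in0 : in_adjoin s 0 by rewrite -(rmorph0 (@ratC R m)); exact: adjoinC.
have in1 : in_adjoin s 1 by rewrite -(rmorph1 (@ratC R m)); exact: adjoinC.
elim/big_ind: _ => // [F G|e _]; first exact: adjoinD.
apply: adjoinM; first exact: adjoinC.
rewrite /mmap1; elim/big_ind: _ => // [F G|j _]; first exact: adjoinM.
by elim: (e j) => [|i IHi]; rewrite ?expr0 // exprS; apply: adjoinM.
Qed.
End Adjoin.

Section ThreePoints.
Variable R : realType.

Lemma adjoin_normal_form (x0 : 'I_(3 * 4) -> R) k :
  in_adjoin (generators R) (normal_form (fun l => ratC _ (x0 l)) (generators R) k).
Proof.
set c0 := fun l => _; set s := generators R.
have hz j : in_adjoin s (s j) by exact: adjoin_gen.
have hc i c : in_adjoin s (coord c0 i c) by exact: adjoinC.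
have hphi i j l : in_adjoin s (phi c0 i j l).
  by apply: adjoinD; apply: adjoinM => //; exact: adjoinB.
have harea : in_adjoin s (area c0).
  by apply: adjoinB; apply: adjoinM; exact: adjoinB.
have h21 := adjoin_div (hz 0) (hphi pt1 pt1 pt2).
have h31 := adjoin_div (hz 2%:R) (hphi pt1 pt1 pt3).
have h32 := adjoin_div (hz 3%:R) (adjoinM (hphi pt1 pt1 pt3) h21).
have h23 := adjoin_div (hz 1) h32.
have hsolve a b i j l t c : in_adjoin s a -> in_adjoin s b -> in_adjoin s
    ((a * (coord c0 i c - coord c0 j c) - b * (coord c0 l c - coord c0 t c))
     / area c0).
  move=> ha hb; apply: adjoin_div => //.
  by apply: adjoinB; apply: adjoinM => //; exact: adjoinB.
case/mxvec_indexP: k => i c; rewrite /normal_form !mxvecE mxE.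
by elim/ord3_ind: i; elim/coord_ind: c => /=; try exact: hc; exact: hsolve.
Qed.

(** F = N / D is constant along orbits, so it equals N(nu) / D(nu) for the
    normal form nu based at a point x0 where D does not vanish. *)
Lemma invariant_adjoin (F : jetfun R 3) :
  abs_invariant F -> in_adjoin (generators R) F.
Proof.
move=> invF; have [N [D [D0 FE]]] := fraction_of F.
have [|x0] := @mpoly_nonroot R _ (genericity (fun k => 'X_k : {mpoly R[3 * 4]}) * D).
  by rewrite mulf_neq0 ?genericity_neq0.
rewrite mevalM meval_genericity mulf_eq0 negb_or => /andP[g0 Dx0].
pose nu := normal_form (fun l => ratC _ (x0 l)) (generators R).
have nuv x P : genericity x != 0 ->
    has_value x (poly_subst nu P) P.@[normal_form x0 (invariants x)].
  by move=> g; apply: has_value_subst => j; exact: has_value_normal_form.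
have cross : poly_subst nu N * tofrac D - tofrac N * poly_subst nu D = 0.
  apply: (eq0_has_value (genericity_neq0 R)) => x; rewrite meval_genericity => g.
  (* Some T moves x to its normal form, so that F has the same value at both. *)
  have hval := has_valueB (has_valueM (nuv x N g) (has_value_poly x D))
    (has_valueM (has_value_poly x N) (nuv x D g)).
  suff E0 : N.@[normal_form x0 (invariants x)] * D.@[x] =
      N.@[x] * D.@[normal_form x0 (invariants x)] by rewrite E0 subrr in hval.
  have [z0 z3] := generic_invariants g.
  have [|T uT [w0 Tx]] := same_orbit g (genericity_normal_form g0 z0 z3).
    by move=> j; rewrite invariants_normal_form.
  have aval P : has_value x (poly_subst (@act R 3 T) P)
      P.@[normal_form x0 (invariants x)].
    by rewrite -(meval_eq P Tx); apply: has_value_subst => j; apply: has_value_act.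
  apply: has_value_uniq (has_valueM (aval N) (has_value_poly x D)) _.
  rewrite (rat_subst_cross D0 FE (invF T uT)) mulrAC FE divfK ?tofrac_eq0 //.
  exact: has_valueM (has_value_poly x N) (aval D).
(* The normal form at x0 is x0 itself, and D does not vanish there. *)
have nuD0 : poly_subst nu D != 0.
  apply: contraNneq Dx0 => nuD; have := nuv x0 D g0; rewrite nuD => D0v.
  rewrite -(meval_eq D (normal_form_invariants g0)); apply/eqP.
  apply: has_value_uniq D0v _.
  by have := has_valueC x0 0; rewrite rmorph0.
have -> : F = poly_subst nu N / poly_subst nu D.
  apply/eqP; rewrite FE eqr_div ?tofrac_eq0 // eq_sym -subr_eq0; exact/eqP.
by apply: adjoin_div; apply: adjoin_subst => j; exact: adjoin_normal_form.
Qed.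

(** A relation P vanishes at every z with nonzero first and last coordinates,
    since the normal form realizes z as values of the generators. *)
Lemma generators_independent : alg_independent (generators R).
Proof.
move=> P P0; apply/eqP/negPn/negP => Pn0.
have [|z] := @mpoly_nonroot R 4 (P * 'X_0 * 'X_(3%:R)).
  by rewrite !mulf_neq0 // -msupp_eq0 msuppX.
rewrite !mevalM !mevalXU !mulf_eq0 !negb_or => /andP[/andP[Pz z0] z3].
have [x0] := mpoly_nonroot (genericity_neq0 R); rewrite meval_genericity => g0.
have hP := has_value_subst P (has_value_generators (normal_form x0 z)).
rewrite P0 (meval_eq P (invariants_normal_form g0 z0 z3)) in hP.
case/eqP: Pz; apply: has_value_uniq hP _.
by have := has_valueC (normal_form x0 z) 0; rewrite rmorph0.
Qed.
End ThreePoints.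

Theorem theorem1 (R : realType) :
  [/\ forall F : jetfun R 3, abs_invariant F <-> in_adjoin (generators R) F,
      forall j : 'I_4, abs_invariant (generators R j)
    & alg_independent (generators R)].
Proof.
split; last exact: generators_independent; last exact: generators_invariant.
by move=> F; split; [exact: invariant_adjoin | exact: adjoin_invariant].
Qed.
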